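(* Let $\mathcal{F}$ be a base-constrained spanning forest with linear-coupled power flow voltages as described in the context, with nodal power injections satisfying Assumption 1 of the context. For every node $a$ (in tree $\mathcal{T}_k$ of $\mathcal{F}$) with set of descendants $D_a^{\mathcal{T}_k}$ and parent $b$, $$b=\arg\min_{c\notin D_a^{\mathcal{T}_k}}\ \mathbb{E}\big[(\varepsilon_a-\mu_{\varepsilon_a})-(\varepsilon_c-\mu_{\varepsilon_c})\big]^2 ,$$ where $\mathbb{E}[\cdot]^2$ denotes the expected value of the square. That is, among all non-descendants $c$ of the node $a$, the minimum expected squared centered difference of voltage magnitude deviations is achieved at the parent node $b$ of $a$.
   Context: Network. $\mathcal{F}$ is a finite forest, the disjoint union of $K\ge 1$ trees $\mathcal{T}_1,\dots,\mathcal{T}_K$ with undirected edge set $\mathcal{E}^{\mathcal{F}}$ (a base-constrained spanning forest). Each tree $\mathcal{T}_k$ contains exactly one substation node (its slack bus, or root), and there are $N$ non-substation nodes in total, labelled $1,\dots,N$. Each edge $(ab)\in\mathcal{E}^{\mathcal{F}}$ has a resistance $r_{ab}>0$ and a reactance $x_{ab}>0$; $r^{\mathcal{F}}$ and $x^{\mathcal{F}}$ are the diagonal matrices of resistances and reactances of the edges. $M$ is the reduced directed incidence matrix: one row per (arbitrarily directed) edge $(ab)$, with entry $+1$ in column $a$ and $-1$ in column $b$, and the columns of substation nodes removed; it is square ($N\times N$) and invertible. Put $H_{1/r}=M^{T}(r^{\mathcal{F}})^{-1}M$ and $H_{1/x}=M^{T}(x^{\mathcal{F}})^{-1}M$ (reduced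 weighted graph Laplacians). Descendants and parents. In tree $\mathcal{T}_k$, node $b$ is a descendant of node $a$ if $a$ lies on the unique path from $b$ to the slack bus of $\mathcal{T}_k$; $D_a^{\mathcal{T}_k}$ is the set of descendants of $a$ within $\mathcal{T}_k$ and it includes $a$ itself. Node $b$ is the parent of $a$ if $a$ is an immediate descendant of $b$ (that is, $b$ is the neighbour of $a$ on the path from $a$ to the slack bus). Linear-coupled power flow. $p,q\in\mathbb{R}^N$ are random vectors (with finite second moments) of active and reactive power injections at the non-substation nodes. The voltage phases $\theta\in\mathbb{R}^N$ and voltage magnitude deviations $\varepsilon\in\mathbb{R}^N$ at the non-substation nodes are given by $$\theta = H_{1/x}^{-1}p - H_{1/r}^{-1}q,\qquad \varepsilon = H_{1/r}^{-1}p+H_{1/x}^{-1}q .$$ At substation nodes the voltage magnitude and phase have zero fluctuation, i.e. $\varepsilon-\mu_\varepsilon=0$ and $\theta-\mu_\theta=0$ there. Moments. For random vectors $y,z$, $\mu_y=\mathbb{E}[y]$, $\Omega_{yz}=\mathbb{E}[(y-\mu_y)(z-\mu_z)^T]$, and $\Omega_y=\Omega_{yy}$. $\mu_{\varepsilon_a}$ denotes the mean of $\varepsilon_a$. Assumption 1 (powers at different nodes are not correlated, while active and reactive powers at the same node are positively correlated). For every non-substation node $a$, $\Omega_{qp}(a,a)>0$; and for all distinct non-substation nodes $a\neq b$, $\Omega_p(a,b)=\Omega_q(a,b)=\Omega_{qp}(a,b)=0$. *)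

(* Defs.v *)
From HB Require Import structures.
From mathcomp Require Import all_boot all_order all_algebra.
From mathcomp Require Import all_classical all_reals all_analysis.

Set Implicit Arguments.
Unset Strict Implicit.
Unset Printing Implicit Defensive.

Import Order.TTheory GRing.Theory Num.Theory.
Import numFieldNormedType.Exports.

Local Open Scope classical_set_scope.
Local Open Scope ring_scope.

(* [inl i] is the i-th non-substation node, [inr k] is the k-th substation,
   which is the slack bus of the k-th tree. *)
Notation node N K := ('I_N + 'I_K)%type.

Definition is_substation N K (v : node N K) : bool :=
  if v is inr _ then true else false.

(* The m edges are enumerated; edge l joins [tail l] and [head l], and this
   (arbitrary) direction only matters for the incidence matrix. *)
Section Forest.
Variables (N K m : nat) (tail head : 'I_m -> node N K).

Definition adjacent : rel (node N K) :=
  [rel u v | [exists l, ((tail l == u) && (head l == v))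
                     || ((tail l == v) && (head l == u))]].

Definition adjacent_in (A : {set node N K}) : rel (node N K) :=
  [rel u v | [&& u \in A, v \in A & adjacent u v]].

Definition is_tree (A : {set node N K}) : Prop :=
  (forall u v, u \in A -> v \in A -> connect (adjacent_in A) u v) /\
  (forall s : seq (node N K), (2 < size s)%N -> ~~ ucycleb (adjacent_in A) s).

Record spanning_forest (tree : 'I_K -> {set node N K}) : Prop := {
  edges_no_loop : forall l, tail l != head l;
  edges_no_dup : forall l l',
    [set tail l; head l]%SET = [set tail l'; head l']%SET -> l = l';
  trees_partition : forall v, exists! k, v \in tree k;
  edges_in_trees : forall l, exists k, (tail l \in tree k) && (head l \in tree k);
  trees_are_trees : forall k, is_tree (tree k);
  trees_substation : forall k s, (inr s \in tree k) = (s == k) }.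

Variables (tree : 'I_K -> {set node N K}) (k : 'I_K).

(* [v :: s] is a simple path, in the k-th tree, from v to its slack bus. *)
Definition slack_path (v : node N K) (s : seq (node N K)) : bool :=
  [&& path (adjacent_in (tree k)) v s, uniq (v :: s) & last v s == inr k].

Definition descendants (a : node N K) : set (node N K) :=
  [set c | c \in tree k /\ exists s, slack_path c s /\ a \in c :: s].

Definition is_parent (b a : node N K) : Prop :=
  exists s, slack_path a (b :: s).

End Forest.

Section PowerFlow.
Variables (R : realType) (N K m : nat) (tail head : 'I_m -> node N K).

Definition incidence : 'M[R]_(m, N) :=
  \matrix_(l, i) ((tail l == inl i)%:R - (head l == inl i)%:R).

Definition reduced_laplacian (z : 'rV[R]_m) : 'M[R]_N :=
  incidence^T *m invmx (diag_mx z) *m incidence.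

(* r and x list the resistances and reactances of the edges. *)
Definition linear_coupled_power_flow (r x : 'rV[R]_m) (T : Type)
    (p q theta eps : T -> 'cV[R]_N) : Prop :=
  forall w,
    theta w = invmx (reduced_laplacian x) *m p w
              - invmx (reduced_laplacian r) *m q w /\
    eps w = invmx (reduced_laplacian r) *m p w
            + invmx (reduced_laplacian x) *m q w.

End PowerFlow.

Section Moments.
Context d (T : measurableType d) (R : realType) (P : probability T R) (N : nat).
Implicit Types y z : T -> 'cV[R]_N.

Definition coordinate y (i : 'I_N) : T -> R := fun w => y w i ord0.

(* Membership in [Lfun] includes measurability. *)
Definition square_integrable_vector y : Prop :=
  forall i, coordinate y i \in Lfun P 2%:E.

Definition mean y : 'cV[R]_N := \col_i fine 'E_P[coordinate y i].

Definition cov_mx y z : 'M[R]_N :=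
  \matrix_(i, j) fine (covariance P (coordinate y i) (coordinate z j)).

Definition uncorrelated_injections (p q : T -> 'cV[R]_N) : Prop :=
  (forall a, 0 < cov_mx q p a a) /\
  (forall a b, a != b ->
    [/\ cov_mx p p a b = 0, cov_mx q q a b = 0 & cov_mx q p a b = 0]).

(* Substations have no fluctuation. *)
Definition fluctuation K y (v : node N K) : T -> R :=
  fun w => if v is inl i then y w i ord0 - mean y i ord0 else 0.

Definition expected_sq_diff K y (a c : node N K) : \bar R :=
  'E_P[fun w => (fluctuation y a w - fluctuation y c w) ^+ 2].

End Moments.

Definition minimizers (R : realType) (X : Type) (D : set X) (f : X -> \bar R) :
    set X :=
  [set u | D u /\ forall v, D v -> (f u <= f v)%E].

(* Main.v *)
Require Import Defs.
From mathcomp Require Import all_boot all_order all_algebra.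
From mathcomp Require Import all_classical all_reals all_analysis.
From mathcomp Require Import ring zify.

(** In a forest the reduced incidence matrix is square once its rows are indexed
    by the lower ends of the edges.  With all edges directed upwards, its inverse
    is the 0/1 matrix of the relation [ancestor]
    ([mul_parent_incidence_ancestor]).  Hence the entry [(i, j)] of the inverse
    of the reduced Laplacian is the total weight of the edges common to the
    paths from [i] and [j] to the substation ([invmx_reduced_laplacian]).
    With the convention that a substation contributes a zero row, this formula
    holds at all nodes.

    The voltages are linear in the injections, and injections at different nodes
    are uncorrelated.  So the expected squared difference between [a] and [c] is
    a sum over nodes [j] of
    [al_j ^ 2 Var(p_j) + 2 al_j be_j Cov(q_j, p_j) + be_j ^ 2 Var(q_j)], where
    [al_j] and [be_j] are the differences of row [a] and row [c] at column [j]
    of the two inverse Laplacians ([expected_sq_diff_response]); each is a [gap]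
    between two overlaps of paths, for the resistances and for the reactances.

    For the parent [b] of [a], the gap at [j] is the weight of the edge [ab] if
    [j] descends from [a], and zero otherwise.  For any other non-descendant [c]
    the edge [ab] is still on the path of [a] but not on that of [c], so that
    the gap at descendants of [a] is at least as large; elsewhere, the
    resistance gap and the reactance gap have the same sign, because the
    ancestors of [j] form a chain.  Therefore each term is minimal at [b]
    ([gap_parent_min]).  If [c] is neither [b] nor, like [b], a substation,
    then some product [al_j be_j] is strictly larger ([gap_parent_strict]), and
    the positive covariance at [j] makes the whole sum strictly larger. *)

Set Implicit Arguments.
Unset Strict Implicit.
Unset Printing Implicit Defensive.

Import Order.TTheory GRing.Theory Num.Theory.

Local Open Scope classical_set_scope.
Local Open Scope ring_scope.

(** * Uniqueness of paths in acyclic graphs *)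

(** If two such paths leave [x] by different steps [u] and [w], their remainders
    join [u] to [w] away from [x]; closing a simple path from [u] to [w] through
    [x] gives a cycle. *)
Lemma acyclic_path_unique (T : finType) (e : rel T) :
  symmetric e -> (forall s, (2 < size s)%N -> ~~ ucycleb e s) ->
  forall x s t, path e x s -> path e x t -> uniq (x :: s) -> uniq (x :: t) ->
  last x s = last x t -> s = t.
Proof.
move=> e_sym e_acyclic x s; elim: s x => [|u s IHs] x [|w t] //=.
- by move=> _ _ _ /andP[xt _] def_x; rewrite def_x mem_last in xt.
- by move=> _ _ /andP[xs _] _ def_x; rewrite -def_x mem_last in xs.
move=> /andP[exu us] /andP[exw wt] /andP[x_us uniq_us] /andP[x_wt uniq_wt].
move=> eq_last.
have [eq_uw | neq_uw] := eqVneq u w.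
  by subst w; congr (_ :: _); apply: (IHs u t).
exfalso.
(* The connection from [u] to [w] must avoid [x], so [x] is deleted. *)
pose e' y z := [&& y != x, z != x & e y z].
have avoid_path y r : x \notin y :: r -> path e y r -> path e' y r.
  elim: r y => //= z r IH y; rewrite !inE !negb_or => /and3P[xy xz xr].
  case/andP=> eyz zr.
  by rewrite /e' eq_sym xy eq_sym xz eyz IH // inE negb_or xz.
have e'_sym : connect_sym e'.
  by apply: sym_connect_sym => y z; rewrite /e' e_sym andbCA.
have : connect e' u w.
  apply: (@connect_trans _ _ (last u s)).
    by apply/connectP; exists s => //; apply: avoid_path.
  by rewrite eq_last e'_sym; apply/connectP; exists t => //; apply: avoid_path.
case/connectP=> r0 /shortenP[r ur uniq_r _] def_w.
have x_r : x \notin u :: r.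
  have: u != x by move: x_us; rewrite inE negb_or eq_sym => /andP[].
  elim: (r) (u) ur => /= [|z r' IH] y; first by rewrite inE eq_sym => _ ->.
  case/andP=> /and3P[_ zx _] zr' yx.
  by rewrite inE negb_or eq_sym yx IH.
have er : path e u r.
  by apply: sub_path ur => y z /and3P[].
have r_gt0 : (0 < size r)%N by case: (r) def_w neq_uw => //= ->; rewrite eqxx.
apply/negP/negPn: (e_acyclic [:: x, u & r] r_gt0).
by rewrite /ucycleb cons_uniq uniq_r x_r /= exu rcons_path er -def_w e_sym exw.
Qed.

(** * Routes to the substations *)

Section RootedForest.
Variables (N K m : nat) (tail head : 'I_m -> node N K).
Variable tree : 'I_K -> {set node N K}.

Lemma adjacent_sym : symmetric (Defs.adjacent tail head).
Proof. by move=> u v; apply: eq_existsb => l; rewrite orbC. Qed.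

Lemma adjacent_in_sym A : symmetric (adjacent_in tail head A).
Proof.
move=> u v; rewrite /adjacent_in [LHS]/= [RHS]/= andbCA.
by do 2!congr (_ && _); exact: adjacent_sym.
Qed.

Hypothesis forest : spanning_forest tail head tree.

Lemma slack_path_tree k v s : slack_path tail head tree k v s -> v \in tree k.
Proof.
case: s => [|u s] /and3P[].
  by move=> _ _ /= /eqP->; rewrite (trees_substation forest).
by case/andP=> /and3P[].
Qed.

Lemma slack_path_unique k v s t :
  slack_path tail head tree k v s -> slack_path tail head tree k v t -> s = t.
Proof.
move=> /and3P[vs uniq_s /eqP last_s] /and3P[vt uniq_t /eqP last_t].
have [_ acyclic] := trees_are_trees forest k.
apply: acyclic_path_unique acyclic _ _ _ vs vt uniq_s uniq_t _.
  exact: adjacent_in_sym.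
by rewrite last_s last_t.
Qed.

(** Connectedness gives the path and acyclicity its uniqueness, so the existential
    notions of descendant and parent can be read off a function. *)
Lemma route_exists : exists route : node N K -> seq (node N K),
  forall k v s, v \in tree k -> slack_path tail head tree k v s = (s == route v).
Proof.
suff /boolp.choice[route routeP] : forall v, exists t, forall k s, v \in tree k ->
    slack_path tail head tree k v s = (s == t) by exists route => k v s; exact: routeP.
move=> v; have [k [vk k_uniq]] := trees_partition forest v.
have [conn _] := trees_are_trees forest k.
have /conn/(_ _)/connectP : v \in tree k by [].
case/(_ (inr k)); first by rewrite (trees_substation forest).
move=> t0 /shortenP[t vt uniq_t _] last_t.
have slack_t : slack_path tail head tree k v t.
  by apply/and3P; split; rewrite // -last_t.
exists t => k' s /k_uniq <-; apply/idP/eqP => [slack_s | -> //].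
exact: slack_path_unique slack_t.
Qed.

(* The function given by [route_exists], kept abstract. *)
Variable route : node N K -> seq (node N K).
Hypothesis routeP : forall k v s, v \in tree k ->
  slack_path tail head tree k v s = (s == route v).

Lemma route_slack_path v : exists k, slack_path tail head tree k v (route v).
Proof.
by have [k [vk _]] := trees_partition forest v; exists k; rewrite routeP.
Qed.

Lemma route_substation k : route (inr k) = [::].
Proof.
apply/eqP; rewrite eq_sym -(routeP (k := k)) ?(trees_substation forest) //.
by rewrite /slack_path /= eqxx.
Qed.

Lemma route_cons v u s : route v = u :: s ->
  Defs.adjacent tail head v u /\ route u = s.
Proof.
have [k] := route_slack_path v; rewrite /slack_path => + def_v.
rewrite def_v => /and3P[/andP[/and3P[vk uk vu]] us /andP[_ uniq_s] last_s].
split=> //; apply/eqP; rewrite eq_sym -(routeP _ uk).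
by apply/and3P.
Qed.

Lemma uniq_route v : uniq (v :: route v).
Proof. by have [k /and3P[]] := route_slack_path v. Qed.

Lemma route_injection i : exists u, route (inl i) = u :: route u.
Proof.
have [k] := route_slack_path (inl i).
case def_i: (route _) => [|u s]; first by case/and3P.
by exists u; have [_ ->] := route_cons def_i.
Qed.

Lemma mem_route_cat v u : u \in v :: route v ->
  exists s, v :: route v = s ++ u :: route u.
Proof.
move def_s: (route v) => s; elim: s v def_s => [|w s IHs] v def_v.
  by rewrite inE => /eqP->; exists [::]; rewrite def_v.
rewrite inE => /orP[/eqP-> | ]; first by exists [::]; rewrite def_v.
have [_ def_w] := route_cons def_v; move=> /(IHs _ def_w)[s' def_s'].
by exists (v :: s'); rewrite def_s'.
Qed.

(** If the route of the tail avoids the head, extending it backwards by the head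
    gives the route of the head.  Otherwise the head must be its first step,
    because the tail followed by the route of the head is then a simple path. *)
Lemma edge_route l : route (tail l) = head l :: route (head l)
  \/ route (head l) = tail l :: route (tail l).
Proof.
have [k /andP[tk hk]] := edges_in_trees forest l.
have th : adjacent_in tail head (tree k) (tail l) (head l).
  by apply/and3P; split=> //; apply/existsP; exists l; rewrite !eqxx.
have [h_t | h_t] := boolP (head l \in tail l :: route (tail l)); last first.
  right; apply/eqP; rewrite eq_sym -(routeP _ hk).
  have:= routeP (route (tail l)) tk; rewrite eqxx => /and3P[tp tu tlast].
  apply/and3P; split; [|by rewrite cons_uniq h_t|by []].
  by apply/andP; split=> //; rewrite adjacent_in_sym.
left; apply/eqP; rewrite eq_sym -(routeP _ tk).
have:= routeP (route (head l)) hk; rewrite eqxx => /and3P[hp hu hlast].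
apply/and3P; split; [by apply/andP| |by []].
rewrite cons_uniq hu andbT.
have [s def_s] := mem_route_cat h_t.
have := uniq_route (tail l); rewrite def_s.
case: s def_s => [|t s] [t_eq _].
  by case/eqP: (edges_no_loop forest l).
rewrite -t_eq.
by rewrite cat_cons cons_uniq mem_cat negb_or => /andP[/andP[]].
Qed.

(** * The ancestor order *)

Definition ancestor u v := u \in v :: route v.

Lemma ancestor_refl v : ancestor v v.
Proof. by rewrite /ancestor mem_head. Qed.

Lemma ancestor_trans u v w : ancestor u v -> ancestor v w -> ancestor u w.
Proof.
move=> uv /mem_route_cat[s def_s].
by rewrite /ancestor def_s mem_cat -/(ancestor u v) uv orbT.
Qed.

(** The routes of [u] and [v] are both suffixes of the route of [w]; the shorter
    one is a suffix of the longer one. *)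
Lemma ancestor_chain u v w : ancestor u w -> ancestor v w ->
  ancestor u v || ancestor v u.
Proof.
move=> /mem_route_cat[s def_s] /mem_route_cat[t def_t].
wlog le_st : s t u v def_s def_t / (size s <= size t)%N.
  move=> IH; case/orP: (leq_total (size s) (size t)) => le; first exact: (IH s t).
  by rewrite orbC; apply: (IH t s).
have def_v : v :: route v = drop (size t - size s) (u :: route u).
  rewrite -(drop_size_cat (v :: route v) (erefl (size t))) -def_t def_s.
  by rewrite drop_cat ltnNge le_st.
by apply/orP; right; apply: (@mem_drop (size t - size s)); rewrite -def_v mem_head.
Qed.

Lemma ancestor_anti u v : ancestor u v -> ancestor v u -> u = v.
Proof.
move=> /mem_route_cat[s def_s] /mem_route_cat[t def_t].
case: s def_s => [|s0 s] def_s; first by case: def_s.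
move: def_t (congr1 size def_s) => /(congr1 size).
by rewrite !size_cat /=; lia.
Qed.

Lemma ancestor_substation v k : ancestor v (inr k) = (v == inr k).
Proof. by rewrite /ancestor route_substation inE. Qed.

Lemma ancestor_parent i u v : route (inl i) = u :: route u ->
  ancestor v (inl i) = (v == inl i) || ancestor v u.
Proof. by move=> def_i; rewrite /ancestor def_i inE. Qed.

Lemma parent_not_below i u : route (inl i) = u :: route u -> ~~ ancestor (inl i) u.
Proof.
by move=> def_i; have := uniq_route (inl i); rewrite def_i => /andP[].
Qed.

Lemma ancestor_in_tree k u v : ancestor u v -> u \in tree k -> v \in tree k.
Proof.
move=> uv uk; have [k' slack_v] := route_slack_path v.
have vk' := slack_path_tree slack_v.
suff uk' : u \in tree k'.
  have [k0 [_ k0_uniq]] := trees_partition forest u.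
  by rewrite -(k0_uniq _ uk) (k0_uniq _ uk').
have [vp _ _] := and3P slack_v.
move: uv; rewrite /ancestor inE => /orP[/eqP-> //|].
elim: (route v) {1}v vp => [|w s IHs] v' /=; first by [].
case/andP=> /and3P[_ wk' _] ws.
rewrite inE => /orP[/eqP->|uws]; [exact: wk' | exact: (IHs w ws uws)].
Qed.

Lemma descendantsE k a c : a \in tree k ->
  descendants tail head tree k a c <-> ancestor a c.
Proof.
move=> ak; split=> [[ck [s []]]|ac]; first by rewrite (routeP _ ck) => /eqP->.
have ck := ancestor_in_tree ac ak.
by split=> //; exists (route c); rewrite (routeP _ ck) eqxx.
Qed.

Lemma parent_route k a b : a \in tree k -> is_parent tail head tree k b a ->
  exists2 i, a = inl i & route (inl i) = b :: route b.
Proof.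
move=> ak [s]; rewrite (routeP _ ak) => /eqP/esym def_a.
case: a ak def_a => [i|k'] ak def_a; last first.
  by rewrite route_substation in def_a.
by exists i => //; rewrite def_a; have [_ ->] := route_cons def_a.
Qed.

(** * Inverse of the reduced Laplacian of a forest *)

(** Both directions of [l] are allowed, since edges are directed arbitrarily. *)
Definition ascends l i := exists2 u, route (inl i) = u :: route u &
  tail l = inl i /\ head l = u \/ tail l = u /\ head l = inl i.

Lemma ascends_ex_edge i : exists l, ascends l i.
Proof.
have [u def_i] := route_injection i.
have [/existsP[l /orP[]/andP[/eqP tl /eqP hl]] _] := route_cons def_i.
  by exists l, u => //; left.
by exists l, u => //; right.
Qed.

Lemma ascends_ex_node l : exists i, ascends l i.
Proof.
case: (edge_route l) => def_l.
  case tl: (tail l) def_l => [i|k] def_l; last first.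
    by move: def_l; rewrite route_substation.
  by exists i, (head l) => //; left.
case hl: (head l) def_l => [i|k] def_l; last first.
  by move: def_l; rewrite route_substation.
by exists i, (tail l) => //; right.
Qed.

Lemma ascends_node_inj l i j : ascends l i -> ascends l j -> i = j.
Proof.
move=> [u def_i li] [v def_j lj].
suff : inl i = inl j :> node N K \/ (v = inl i /\ u = inl j).
  case=> [[]//|[v_i u_j]]; have := parent_not_below def_i.
  by rewrite u_j /ancestor def_j v_i inE mem_head orbT.
by case: li lj => [] [-> ->] [] []; intuition.
Qed.

Lemma ascends_edge_inj l l' i : ascends l i -> ascends l' i -> l = l'.
Proof.
move=> [u def_i li] [v]; rewrite def_i => -[<- _] l'i.
apply: (edges_no_dup forest).
by case: li l'i => [] [-> ->] [] [-> ->] //; rewrite finset.setUC.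
Qed.

(** Every edge has one lower end and every non-substation node one edge above it.
    This is the count of edges in a forest, and reindexing by it makes the
    incidence matrix square. *)
Lemma ascending_edges : exists2 up : 'I_N -> 'I_m,
  bijective up & forall i, ascends (up i) i.
Proof.
have [up upP] := boolp.choice ascends_ex_edge.
have [down downP] := boolp.choice ascends_ex_node.
exists up => //; exists down => [i | l].
  exact: ascends_node_inj (downP _) (upP i).
exact: ascends_edge_inj (upP _) (downP l).
Qed.

Variable R : realType.

Definition ancestor_mx : 'M[R]_N := \matrix_(i, j) (ancestor (inl j) (inl i))%:R.

(** The reduced incidence matrix with each row indexed by the lower end of its
    edge and directed upwards.  When the parent is a substation the second term
    is zero for all [j], as the column of the substation is removed. *)
Definition parent_incidence : 'M[R]_N :=
  \matrix_(i, j) ((i == j)%:R - (ohead (route (inl i)) == Some (inl j))%:R).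

(** Row [i] of the product is the difference of the ancestor indicators of [i] and
    of its parent, and these differ only at [i] itself. *)
Lemma mul_parent_incidence_ancestor : parent_incidence *m ancestor_mx = 1%:M.
Proof.
apply/matrixP => i k; rewrite !mxE.
have [u def_i] := route_injection i.
rewrite (eq_bigr (fun j => (i == j)%:R * (ancestor (inl k) (inl j))%:R
  - (u == inl j)%:R * (ancestor (inl k) (inl j))%:R)); last first.
  by move=> j _; rewrite !mxE def_i /= -mulrBl.
rewrite sumrB (bigD1 i) //= eqxx mul1r big1 ?addr0; last first.
  by move=> j; rewrite eq_sym => /negPf->; rewrite mul0r.
have -> : \sum_j (u == inl j)%:R * (ancestor (inl k) (inl j))%:R
    = (ancestor (inl k) u)%:R :> R.
  case: u {def_i} => [j|k'].
    rewrite (bigD1 j) //= eqxx mul1r big1 ?addr0 // => j' j'j.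
    by rewrite (inj_eq inl_inj) eq_sym (negPf j'j) mul0r.
  by rewrite big1 ?ancestor_substation // => j _; rewrite mul0r.
rewrite (ancestor_parent _ def_i) (inj_eq inl_inj) eq_sym.
have [ki|_] := eqVneq i k; last by rewrite subrr.
by rewrite -ki (negPf (parent_not_below def_i)) subr0.
Qed.

(** The sign [e] records the direction of the edge; it is squared in the
    Laplacian. *)
Lemma incidence_ascends l i : ascends l i -> exists e : R, e * e = 1 /\
  forall j, incidence R tail head l j = e * parent_incidence i j.
Proof.
move=> [u def_i li].
have u_i : (u == inl i) = false.
  apply/negbTE/eqP => u_i.
  by have := parent_not_below def_i; rewrite u_i ancestor_refl.
case: li => [] [tl hl]; [exists 1|exists (-1)]; (split; first by ring) => j;
  rewrite !mxE tl hl def_i /= (inj_eq inl_inj) -[Some u == _]/(u == inl j);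
  ring.
Qed.

Lemma invmx_diag (F : fieldType) n (z : 'rV[F]_n) : (forall l, z ord0 l != 0) ->
  invmx (diag_mx z) = diag_mx (\row_l (z ord0 l)^-1).
Proof.
move=> z_neq0; have zK : diag_mx (\row_l (z ord0 l)^-1) *m diag_mx z = 1%:M.
  rewrite mulmx_diag -diag_const_mx; congr diag_mx; apply/rowP => l.
  by rewrite !mxE mulVf.
by rewrite -[LHS]mul1mx -zK mulmxK //; case: (mulmx1_unit zK).
Qed.

Variable up : 'I_N -> 'I_m.
Hypothesis up_bij : bijective up.
Hypothesis upP : forall i, ascends (up i) i.

Lemma reduced_laplacian_ascends (z : 'rV[R]_m) : (forall l, 0 < z ord0 l) ->
  reduced_laplacian tail head z =
  parent_incidence^T *m diag_mx (\row_i (z ord0 (up i))^-1) *m parent_incidence.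
Proof.
move=> z_gt0; apply/matrixP => i j.
rewrite /reduced_laplacian invmx_diag => [|l]; last by rewrite gt_eqF.
rewrite !mul_mx_diag !mxE.
rewrite (reindex up) /=; last exact: onW_bij.
apply: eq_bigr => l _; have [e [ee inc]] := incidence_ascends (upP l).
have := inc i; have := inc j; rewrite !mxE => -> ->.
by rewrite mulrCA !mulrA ee mul1r.
Qed.

(** The Laplacian factors through [parent_incidence], whose inverse is
    [ancestor_mx].  The resulting entry is the total weight of the edges common
    to the paths from [i] and from [j] to the substation. *)
Lemma invmx_reduced_laplacian (z : 'rV[R]_m) i j : (forall l, 0 < z ord0 l) ->
  invmx (reduced_laplacian tail head z) i j =
  \sum_k (ancestor (inl k) (inl i))%:R * (ancestor (inl k) (inl j))%:R
    * z ord0 (up k).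
Proof.
move=> z_gt0; set L := reduced_laplacian _ _ _.
pose B := ancestor_mx *m diag_mx (\row_i z ord0 (up i)) *m ancestor_mx^T.
have LB : L *m B = 1%:M.
  rewrite /L /B reduced_laplacian_ascends // !mulmxA.
  rewrite -[X in X *m _ *m _]mulmxA mul_parent_incidence_ancestor mulmx1.
  rewrite -[X in X *m _]mulmxA mulmx_diag.
  have -> : diag_mx (\row_l ((\row_i (z ord0 (up i))^-1) ord0 l *
      (\row_i z ord0 (up i)) ord0 l)) = 1%:M :> 'M[R]_N.
    rewrite -diag_const_mx; congr diag_mx; apply/rowP => l.
    by rewrite !mxE mulVf // gt_eqF.
  by rewrite mulmx1 -trmx_mul (mulmx1C mul_parent_incidence_ancestor) trmx1.
have -> : invmx L = B.
  by rewrite -[LHS]mulmx1 -LB mulKmx //; case: (mulmx1_unit LB).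
rewrite /B mul_mx_diag mxE; apply: eq_bigr => k _; rewrite !mxE; ring.
Qed.

(** * Comparison of overlaps of routes *)

Local Notation anc := (fun k v => (ancestor (inl k) v)%:R).

(** The overlap of the routes of [u] and [j] minus that of the routes of [v] and
    [j], each edge being counted with weight [w]. *)
Definition gap (w : 'I_N -> R) (u v : node N K) (j : 'I_N) : R :=
  \sum_k anc k (inl j) * (anc k u - anc k v) * w k.

Lemma gapC w u v j : gap w v u j = - gap w u v j.
Proof. by rewrite -sumrN; apply: eq_bigr => k _; ring. Qed.

(** The situation in which no summand of [gap w u v j] is negative. *)
Definition covers u v j :=
  forall k, ancestor (inl k) (inl j) -> ancestor (inl k) v -> ancestor (inl k) u.

Lemma gap_ge (D : {set 'I_N}) w u v j : (forall k, 0 < w k) -> covers u v j ->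
  (forall k, k \in D -> [/\ ancestor (inl k) (inl j), ancestor (inl k) u
                         & ~~ ancestor (inl k) v]) ->
  \sum_(k in D) w k <= gap w u v j.
Proof.
move=> w_gt0 vu D_uv; rewrite big_mkcond; apply: ler_sum => k _.
case: ifP => [/D_uv[-> -> /negPf->] | _]; first by rewrite subr0 !mul1r.
have [/vu vu_k|_] := boolP (ancestor _ (inl j)); last by rewrite !mul0r.
apply: mulr_ge0; last exact/ltW.
by rewrite mul1r subr_ge0 ler_nat; case: ancestor vu_k => // ->.
Qed.

Lemma gap_ge0 w u v j : (forall k, 0 < w k) -> covers u v j -> 0 <= gap w u v j.
Proof.
move=> w_gt0 vu; have := @gap_ge finset.set0 w u v j w_gt0 vu.
by rewrite big_set0; apply => k; rewrite inE.
Qed.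

(** The edges that the route of [j] shares with any other route form a final
    segment of it, and two final segments are nested. *)
Lemma covers_total u v j : covers u v j \/ covers v u j.
Proof.
have [vu|/existsNP[k]] := pselect (covers u v j); first by left.
move=> /not_implyP[kj /not_implyP[kv ku]]; right => k' k'j k'u.
case/orP: (ancestor_chain kj k'j) => [kk'|k'k].
  by case: ku; exact: ancestor_trans kk' k'u.
exact: ancestor_trans k'k kv.
Qed.

(** The sign of a gap depends on the nesting of the overlaps, not on the weights. *)
Lemma gap_mul_ge0 w w' u v j : (forall k, 0 < w k) -> (forall k, 0 < w' k) ->
  0 <= gap w u v j * gap w' u v j.
Proof.
move=> w_gt0 w'_gt0; have [vu|uv] := covers_total u v j.
  by rewrite mulr_ge0 ?gap_ge0.
by rewrite (gapC w v u) (gapC w' v u) mulrNN mulr_ge0 ?gap_ge0.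
Qed.

Section ParentGap.
Variables (i : 'I_N) (b : node N K).
Hypothesis parent_b : route (inl i) = b :: route b.

(** The route of [i] is that of its parent with one more edge, which is shared with
    [j] exactly when [j] descends from [i]. *)
Lemma gap_parent w j : gap w (inl i) b j = anc i (inl j) * w i.
Proof.
rewrite /gap (bigD1 i) //= big1 ?addr0 => [|k ki].
  by rewrite ancestor_refl (negPf (parent_not_below parent_b)) subr0 mulr1.
by rewrite (ancestor_parent _ parent_b) (inj_eq inl_inj) (negPf ki) subrr mulr0 mul0r.
Qed.

Lemma covers_not_below c j : ~~ ancestor (inl i) c ->
  ancestor (inl i) (inl j) -> covers (inl i) c j.
Proof.
move=> ic ij k kj kc; case/orP: (ancestor_chain kj ij) => // ik.
by case/negP: ic; exact: ancestor_trans ik kc.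
Qed.

(** The edge above [i] is shared by the routes of [i] and [j] but is not on the
    route of [c]. *)
Lemma gap_not_below w c j : (forall k, 0 < w k) -> ~~ ancestor (inl i) c ->
  ancestor (inl i) (inl j) ->
  w i <= gap w (inl i) c j.
Proof.
move=> w_gt0 ic ij.
have := gap_ge (D := [set i]%SET) w_gt0 (covers_not_below ic ij); rewrite big_set1.
by apply=> k; rewrite inE => /eqP->; split=> //; exact: ancestor_refl.
Qed.

Lemma gap_parent_min w w' c j : (forall k, 0 < w k) -> (forall k, 0 < w' k) ->
  ~~ ancestor (inl i) c ->
  gap w (inl i) b j * gap w' (inl i) b j <= gap w (inl i) c j * gap w' (inl i) c j.
Proof.
move=> w_gt0 w'_gt0 ic; rewrite !gap_parent.
have [ij|_] := boolP (ancestor _ (inl j)); last by rewrite !mul0r gap_mul_ge0.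
by rewrite !mul1r ler_pM ?gap_not_below // ltW.
Qed.

(** Either [b] has an edge above it that is not on the route of [c], and this edge
    adds to the gap at [i]; or [c] has an edge above it that is not on the route
    of [i], and this edge makes the gap at [c] nonzero, while that of the parent
    vanishes there because [c] does not descend from [i]. *)
Lemma gap_parent_strict w w' c : (forall k, 0 < w k) -> (forall k, 0 < w' k) ->
  ~~ ancestor (inl i) c ->
  c != b -> ~~ (is_substation b && is_substation c) ->
  exists j, gap w (inl i) b j * gap w' (inl i) b j
    < gap w (inl i) c j * gap w' (inl i) c j.
Proof.
move=> w_gt0 w'_gt0 ic cb not_subs.
have [[i' [b_i' bc]]|b_above] : (exists i', b = inl i' /\ ~~ ancestor b c) \/
    (is_substation b \/ ancestor b c).
- case: (b) => [i'|k]; last by right; left.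
  by have [|bc] := boolP (ancestor (inl i') c); [right; right | left; exists i'].
- exists i; rewrite !gap_parent ancestor_refl !mul1r.
  have ii' : i' != i.
    apply: contraNneq (parent_not_below parent_b) => <-.
    by rewrite b_i' ancestor_refl.
  have strict w0 : (forall k, 0 < w0 k) -> w0 i < gap w0 (inl i) c i.
    move=> w0_gt0; apply: (@lt_le_trans _ _ (\sum_(k in [set i'; i]%SET) w0 k)).
      by rewrite big_setU1 ?inE //= big_set1 ltrDr.
    apply: gap_ge => // k; rewrite !inE => /orP[] /eqP->; last by rewrite ancestor_refl.
    by rewrite -b_i' bc (ancestor_parent _ parent_b) ancestor_refl orbT.
  by rewrite ltr_pM ?strict // ltW.
case: c ic cb not_subs b_above => [j|k] ic cb not_subs b_above; last first.
  case: b_above => [b_sub|]; first by rewrite b_sub in not_subs.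
  by rewrite ancestor_substation eq_sym (negPf cb).
have ci : ~~ ancestor (inl j) (inl i).
  rewrite (ancestor_parent _ parent_b) negb_or; apply/andP; split.
    by apply: contraNneq ic => ->; exact: ancestor_refl.
  case: b_above => [|bc].
    by case: (b) => // k _; rewrite ancestor_substation.
  by apply/negP => /(ancestor_anti bc) bj; rewrite bj eqxx in cb.
exists j; rewrite !gap_parent (negPf ic) !mul0r.
have neg w0 : (forall k, 0 < w0 k) -> 0 < gap w0 (inl j) (inl i) j.
  move=> w0_gt0; apply: (lt_le_trans (w0_gt0 j)).
  have := @gap_ge [set j]%SET w0 (inl j) (inl i) j w0_gt0; rewrite big_set1.
  apply=> [k kj _ //|k]; rewrite inE => /eqP->.
  by rewrite ancestor_refl.
by rewrite (gapC w (inl j)) (gapC w' (inl j)) mulrNN mulr_gt0 ?neg.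
Qed.

End ParentGap.

(** Substations get a zero row because their voltage does not fluctuate; it agrees
    with the overlap formula, a substation having no edge above it. *)
Definition node_row (A : 'M[R]_N) (v : node N K) (j : 'I_N) : R :=
  if v is inl i then A i j else 0.

Lemma node_row_gap (z : 'rV[R]_m) u v j : (forall l, 0 < z ord0 l) ->
  node_row (invmx (reduced_laplacian tail head z)) u j -
  node_row (invmx (reduced_laplacian tail head z)) v j =
  gap (fun k => z ord0 (up k)) u v j.
Proof.
move=> z_gt0.
have rowE u' : node_row (invmx (reduced_laplacian tail head z)) u' j =
    \sum_k (ancestor (inl k) (inl j))%:R * (ancestor (inl k) u')%:R
      * z ord0 (up k).
  case: u' => [i|k] /=.
    rewrite invmx_reduced_laplacian //.
    by apply: eq_bigr => k _; rewrite [X in X * _]mulrC.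
  rewrite big1 // => k' _.
  by rewrite ancestor_substation mulr0 mul0r.
by rewrite !rowE -sumrB; apply: eq_bigr => k _; rewrite mulrBr mulrBl.
Qed.

End RootedForest.

(** * Second moments of linear responses *)

Section SecondMoments.
Context d (T : measurableType d) (R : realType) (P : probability T R).

Lemma expectation_lincomb (I : finType) (c : I -> R) (f : I -> T -> R) :
  (forall i, f i \in Lfun P 1) ->
  expectation P (fun w => \sum_i c i * f i w) =
  (\sum_i c i * fine (expectation P (f i)))%:E.
Proof.
move=> f1; suff [] : (fun w => \sum_i c i * f i w) \in Lfun P 1 /\
  expectation P (fun w => \sum_i c i * f i w) =
  (\sum_i c i * fine (expectation P (f i)))%:E by [].
elim: (index_enum I) => [|i s [s1 Es]].
  under eq_fun do rewrite big_nil.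
  by rewrite big_nil expectation_cst; split=> //; exact: Lfun_cst.
have -> : (fun w => \sum_(j <- i :: s) c j * f j w)
    = c i \o* f i \+ (fun w => \sum_(j <- s) c j * f j w).
  by apply/funext => w; rewrite big_cons /= mulrC.
have cf1 : c i \o* f i \in Lfun P 1 by exact: Lfun_scale.
split; first exact: rpredD.
rewrite expectationD // expectationZl // Es big_cons EFinD EFinM fineK //.
exact: expectation_fin_num.
Qed.

Lemma expectation_sqr_lincomb (I : finType) (c : I -> R) (f : I -> T -> R) :
  (forall i, f i \in Lfun P 2%:E) ->
  (expectation P (fun w => (\sum_i c i * f i w) ^+ 2)) =
  (\sum_i \sum_j c i * c j * fine (expectation P (f i \* f j)))%:E.
Proof.
move=> f2.
rewrite pair_big -expectation_lincomb; last first.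
  by move=> [i j]; exact: Lfun2_mul_Lfun1.
congr expectation; apply/funext => w.
rewrite expr2 big_distrlr pair_big /=; apply: eq_bigr => -[i j] _ /=; ring.
Qed.

Variable N : nat.
Implicit Types y z : T -> 'cV[R]_N.

Lemma Lfun1_coordinate y i : square_integrable_vector P y ->
  coordinate y i \in Lfun P 1.
Proof. by move=> y2; apply: Lfun_subset12; [exact: fin_num_measure | exact: y2]. Qed.

Definition centered y i : T -> R := fun w => y w i ord0 - mean P y i ord0.

Lemma Lfun2_centered y i : square_integrable_vector P y ->
  centered y i \in Lfun P 2%:E.
Proof.
move=> y2; have -> : centered y i = coordinate y i \- cst (mean P y i ord0) by [].
by apply: rpredB => // [|?]; [rewrite lee1n | exact: Lfun_cst].
Qed.

Lemma cov_mxE y z i j : cov_mx P y z i j =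
  fine (expectation P (centered y i \* centered z j)).
Proof.
rewrite mxE unlock; congr (fine (expectation P _)); apply/funext => w.
by rewrite /centered !mxE.
Qed.

Lemma cov_mxC y z i j : cov_mx P y z i j = cov_mx P z y j i.
Proof. by rewrite !mxE covarianceC. Qed.

Lemma cov_mx_ge0 y i : 0 <= cov_mx P y y i i.
Proof. by rewrite mxE fine_ge0 //; exact: variance_ge0. Qed.

Section LinearResponse.
Variables (p q y : T -> 'cV[R]_N) (A B : 'M[R]_N).
Hypothesis p2 : square_integrable_vector P p.
Hypothesis q2 : square_integrable_vector P q.
Hypothesis yE : forall w, y w = A *m p w + B *m q w.

Lemma mean_response i :
  mean P y i ord0 =
  \sum_j A i j * mean P p j ord0 + \sum_j B i j * mean P q j ord0.
Proof.
pose c (s : 'I_N + 'I_N) := match s with inl j => A i j | inr j => B i j end.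
pose f (s : 'I_N + 'I_N) :=
  match s with inl j => coordinate p j | inr j => coordinate q j end.
have yf : coordinate y i = fun w => \sum_s c s * f s w.
  by apply/funext => w; rewrite /coordinate yE !mxE big_sumType.
rewrite mxE yf expectation_lincomb.
  rewrite big_sumType /=; by congr (_ + _); apply: eq_bigr => j _; rewrite mxE.
by case=> j; exact: Lfun1_coordinate.
Qed.

Lemma fluctuation_response K (v : node N K) w : fluctuation P y v w =
  \sum_j node_row A v j * centered p j w
  + \sum_j node_row B v j * centered q j w.
Proof.
case: v => [i|k] /=; last by rewrite !big1 ?addr0 // => j _; rewrite mul0r.
rewrite mean_response yE !mxE.
transitivity (\sum_j (A i j * p w j ord0 - A i j * mean P p j ord0) +
  \sum_j (B i j * q w j ord0 - B i j * mean P q j ord0)).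
  by rewrite !sumrB; ring.
by congr (_ + _); apply: eq_bigr => j _; rewrite /centered mulrBr.
Qed.

Hypothesis pq_uncorrelated : uncorrelated_injections P p q.

(** All covariances between injections at different nodes vanish, so only
    products of injections at the same node survive in the square. *)
Lemma expected_sq_diff_response K (a c : node N K) :
  expected_sq_diff P y a c =
  (\sum_j ((node_row A a j - node_row A c j) ^+ 2 * cov_mx P p p j j +
    (node_row A a j - node_row A c j) * (node_row B a j - node_row B c j) *
      cov_mx P q p j j *+ 2 +
    (node_row B a j - node_row B c j) ^+ 2 * cov_mx P q q j j))%:E.
Proof.
pose al j := node_row A a j - node_row A c j.
pose be j := node_row B a j - node_row B c j.
(* The coordinates of [p] and [q] form one family of 2N variables. *)
pose g (s : 'I_N + 'I_N) := match s with inl j => al j | inr j => be j end.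
pose f (s : 'I_N + 'I_N) :=
  match s with inl j => centered p j | inr j => centered q j end.
have -> : expected_sq_diff P y a c =
    expectation P (fun w => (\sum_s g s * f s w) ^+ 2).
  congr expectation; apply/funext => w.
  rewrite !fluctuation_response big_sumType /= opprD addrACA -!sumrB.
  by congr ((_ + _) ^+ 2); apply: eq_bigr => j _; rewrite mulrBl.
rewrite expectation_sqr_lincomb; last by case=> j; exact: Lfun2_centered.
have [_ off_diag] := pq_uncorrelated.
have diag (F : 'I_N -> 'I_N -> R) i :
    (forall j, i != j -> F i j = 0) -> \sum_j F i j = F i i.
  by move=> F0; rewrite (bigD1 i) //= big1 ?addr0 // => j; rewrite eq_sym; exact: F0.
congr (_%:E); rewrite big_sumType /= -big_split /=; apply: eq_bigr => i _.
rewrite !big_sumType /= -/(al i) -/(be i).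
have cov_sum (r : R) (h : 'I_N -> R) (y' z' : T -> 'cV[R]_N) :
    (forall j, i != j -> cov_mx P y' z' i j = 0) ->
    \sum_j r * h j * fine (expectation P (centered y' i \* centered z' j))
    = r * h i * cov_mx P y' z' i i.
  move=> cov0.
  rewrite (diag (fun j k =>
    r * h k * fine (expectation P (centered y' j \* centered z' k)))).
    by rewrite cov_mxE.
  by move=> j ij; rewrite -cov_mxE cov0 ?mulr0.
rewrite !cov_sum; first last.
- by move=> j ij; have [] := off_diag _ _ ij.
- by move=> j ij; rewrite cov_mxC; move: ij; rewrite eq_sym => /off_diag[].
- by move=> j ij; have [] := off_diag _ _ ij.
- by move=> j ij; have [] := off_diag _ _ ij.
rewrite (cov_mxC q p); ring.
Qed.

End LinearResponse.
End SecondMoments.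

(** * Minimality of the parent *)

Section QuadraticForm.
Variables (R : numDomainType) (I : finType) (P Q C : I -> R).
Hypotheses (P_ge0 : forall i, 0 <= P i) (Q_ge0 : forall i, 0 <= Q i).
Hypothesis C_gt0 : forall i, 0 < C i.

(** The variance of [a i * p_i + b i * q_i] when [P], [Q] and [C] hold the variances
    and the covariance of [p_i] and [q_i]. *)
Definition quad (a b : I -> R) i :=
  a i ^+ 2 * P i + a i * b i * C i *+ 2 + b i ^+ 2 * Q i.

Variables a b a' b' : I -> R.
Hypotheses (le_aa : forall i, a i * a i <= a' i * a' i)
  (le_bb : forall i, b i * b i <= b' i * b' i)
  (le_ab : forall i, a i * b i <= a' i * b' i).

Lemma ler_quad i : quad a b i <= quad a' b' i.
Proof.
by rewrite /quad !expr2 !lerD ?lerMn2r ?ler_wpM2r // ltW.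
Qed.

(** Strictness has to come from the mixed products, since only their coefficients
    [C] are known to be nonzero. *)
Lemma ltr_sum_quad : (exists i, a i * b i < a' i * b' i) ->
  \sum_i quad a b i < \sum_i quad a' b' i.
Proof.
case=> i lt_ab; rewrite (bigD1 i) //= [X in _ < X](bigD1 i) //=.
apply: ltr_leD; last by apply: ler_sum => j _; exact: ler_quad.
rewrite /quad !expr2 ltr_leD ?ler_wpM2r // ler_ltD ?ler_wpM2r //.
by rewrite ltrMn2r /= ltr_pM2r.
Qed.

End QuadraticForm.

Theorem theorem2 (R : realType) (d : measure_display) (T : measurableType d)
    (P : probability T R) (N K m : nat) (tail head : 'I_m -> node N K)
    (tree : 'I_K -> {set node N K}) (r x : 'rV[R]_m)
    (p q theta eps : T -> 'cV[R]_N) (k : 'I_K) (a b : node N K) :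
  (1 <= K)%N ->
  spanning_forest tail head tree ->
  (forall l, 0 < r ord0 l) ->
  (forall l, 0 < x ord0 l) ->
  square_integrable_vector P p ->
  square_integrable_vector P q ->
  linear_coupled_power_flow tail head r x p q theta eps ->
  uncorrelated_injections P p q ->
  a \in tree k ->
  is_parent tail head tree k b a ->
  (* zero-fluctuation substations cannot be told apart, hence the second set *)
  minimizers (~` descendants tail head tree k a)
    (fun c => expected_sq_diff P eps a c)
  = [set b] `|` [set c | is_substation b && is_substation c].
Proof.
move=> _ forest r_gt0 x_gt0 p2 q2 flow pq_unc ak parent_b.
have [route routeP] := route_exists forest.
have [up up_bij upP] := ascending_edges forest routeP.
have [i a_i def_i] := parent_route forest routeP ak parent_b.
pose wr j := r ord0 (up j); pose wx j := x ord0 (up j).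
have wr_gt0 j : 0 < wr j := r_gt0 _.
have wx_gt0 j : 0 < wx j := x_gt0 _.
pose f c := \sum_j quad (fun j => cov_mx P p p j j) (fun j => cov_mx P q q j j)
  (fun j => cov_mx P q p j j) (gap route wr a c) (gap route wx a c) j.
have fE c : expected_sq_diff P eps a c = (f c)%:E.
  rewrite (expected_sq_diff_response p2 q2 (fun w => proj2 (flow w)) pq_unc).
  congr (_%:E); apply: eq_bigr => j _.
  by rewrite !(node_row_gap forest routeP up_bij upP).
have [C_gt0 _] := pq_unc.
have le_gap w w' c j (w0 : forall k, 0 < w k) (w'0 : forall k, 0 < w' k) :
    ~~ ancestor route a c -> gap route w a b j * gap route w' a b j <=
      gap route w a c j * gap route w' a c j.
  by rewrite a_i; exact: (gap_parent_min forest routeP).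
have f_min c : ~~ ancestor route a c -> f b <= f c.
  move=> ac; apply: ler_sum => j _.
  (* The two squares are products of a gap with itself. *)
  apply: ler_quad => *; [exact: cov_mx_ge0|exact: cov_mx_ge0|exact: C_gt0| | | ];
    exact: le_gap.
have f_strict c : ~~ ancestor route a c -> c != b ->
    ~~ (is_substation b && is_substation c) -> f b < f c.
  move=> ac cb not_subs; apply: ltr_sum_quad => [j|j|j|j|j|j|].
  - exact: cov_mx_ge0.
  - exact: cov_mx_ge0.
  - exact: C_gt0.
  - exact: le_gap.
  - exact: le_gap.
  - exact: le_gap.
  - rewrite a_i in ac *; exact: (gap_parent_strict forest routeP).
have b_above : ~~ ancestor route a b by rewrite a_i (parent_not_below forest routeP).
have nondesc c : (~` descendants tail head tree k a) c <-> ~~ ancestor route a c.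
  split=> [nc|/negP nc]; last by move/(descendantsE forest routeP _ ak).
  by apply/negP => /(descendantsE forest routeP _ ak).
apply/seteqP; split=> c.
  (* A minimizer that is neither [b] nor a substation together with [b] would
     have a value above that of [b]. *)
  case=> /nondesc ac c_min; have [->|cb] := eqVneq c b; first by left.
  right; apply/negPn/negP => not_subs.
  have := c_min b (proj2 (nondesc b) b_above).
  by rewrite !fE lee_fin leNgt f_strict.
move=> c_bs; suff [ac f_cb] : ~~ ancestor route a c /\ f c = f b.
  split; first exact/nondesc.
  by move=> v /nondesc av; rewrite !fE lee_fin f_cb f_min.
case: c_bs => [->//|/= /andP[]].
case: b {parent_b def_i f_min f_strict le_gap b_above} @f {fE} => // kb f _.
case: c => // kc _; rewrite (ancestor_substation forest routeP) a_i; split=> //.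
(* No edge lies above a substation, so all substations have the same gaps. *)
have same_gap w j : gap route w a (inr kc) j = gap route w a (inr kb) j.
  by apply: eq_bigr => j' _; rewrite !(ancestor_substation forest routeP).
by apply: eq_bigr => j _; rewrite /quad !same_gap.
Qed.
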